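(* Let $\vdash$ be a deductive system that has an inconsistency lemma, and let $\mathsf{K}$ be a quasivariety that algebraizes $\vdash$. Then the following conditions are equivalent. (i) $\vdash$ has a weak excluded middle law (WEML). (ii) Every nontrivial algebra in $\mathsf{K}_{\mathrm{RFSI}}$ has a greatest proper $\mathsf{K}$-congruence (i.e., it has a greatest proper $\vdash$-filter). (iii) Every algebra in $\mathsf{K}_{\mathrm{RSI}}$ has a greatest proper $\mathsf{K}$-congruence.
   Context: Deductive systems. Fix an algebraic signature and an infinite set of variables; $\mathit{Fm}$ is the set of formulas (terms) and $\boldsymbol{Fm}$ the absolutely free algebra of formulas. Substitutions are endomorphisms of $\boldsymbol{Fm}$. A deductive system $\vdash$ is a relation from sets of formulas to formulas that is reflexive ($\Gamma\vdash\alpha$ if $\alpha\in\Gamma$), transitive (if $\Gamma\vdash\alpha$ for all $\alpha\in\Pi$ and $\Pi\vdash\beta$, then $\Gamma\vdash\beta$), finitary (if $\Gamma\vdash\alpha$ then $\Gamma'\vdash\alpha$ for some finite $\Gamma'\subseteq\Gamma$) and substitution-invariant (if $\Gamma\vdash\alpha$ then $s[\Gamma]\vdash s(\alpha)$ for every substitution $s$). $\Gamma\vdash\Pi$ means $\Gamma\vdash\alpha$ for all $\alpha\in\Pi$. Let $v_1,v_2,\dots$ be a fixed sequence of distinct variables, $\mathbb{N}^+=\{1,2,\dots\}$, and let $\mathit{Fm}(n)$ be the set of formulas whose variables are among $v_1,\dots,v_n$. For $\Psi\subseteq\mathit{Fm}(n)$, $\Psi(\alpha_1,\dots,\alpha_n)$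 denotes the result of substituting $\alpha_i$ for $v_i$ in all members of $\Psi$. Inconsistency lemma and WEML. A set $\Xi$ of formulas is inconsistent in $\vdash$ if $\Xi\vdash\alpha$ for all $\alpha\in\mathit{Fm}$. An elementary IL-sequence for $\vdash$ is a family $\{\Psi_n:n\in\mathbb{N}^+\}$ of finite sets $\Psi_n\subseteq\mathit{Fm}(n)$ such that for all $n\in\mathbb{N}^+$ and all $\Gamma\cup\{\alpha_1,\dots,\alpha_n\}\subseteq\mathit{Fm}$: $\Gamma\cup\{\alpha_1,\dots,\alpha_n\}$ is inconsistent in $\vdash$ iff $\Gamma\vdash\Psi_n(\alpha_1,\dots,\alpha_n)$. $\vdash$ has an inconsistency lemma (IL) if it has an elementary IL-sequence. Given such a sequence, let $\#n=|\Psi_n|$, $\Psi_n=\{\psi_n^1,\dots,\psi_n^{\#n}\}$ and $\Psi_{\#n}\Psi_n=\Psi_{\#n}(\psi_n^1,\dots,\psi_n^{\#n})\subseteq\mathit{Fm}(n)$ (the order of enumeration is immaterial up to interderivability). $\vdash$ has a WEML if it has an elementary IL-sequence $\{\Psi_n\}$ such that for all $n\in\mathbb{N}^+$ and all $\Gamma\cup\{\alpha_1,\dots,\alpha_n,\varphi\}\subseteq\mathit{Fm}$: if $\Gamma\cup\Psi_n(\alpha_1,\dots,\alpha_n)\vdash\varphi$ and $\Gamma\cup\Psi_{\#n}\Psi_n(\alpha_1,\dots,\alpha_n)\vdash\varphi$, then $\Gamma\vdash\varphi$. (If $\Psi_n=\emptyset$, this condition for $n$ is trivially true.) Filters and algebraization.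 Algebras are non-empty and have the signature of $\vdash$. A $\vdash$-filter of an algebra $\boldsymbol{A}$ is a set $F\subseteq A$ such that whenever $\Gamma\vdash\alpha$ and $h\colon\boldsymbol{Fm}\to\boldsymbol{A}$ is a homomorphism with $h[\Gamma]\subseteq F$, then $h(\alpha)\in F$. The $\vdash$-filters of $\boldsymbol{A}$ form a complete lattice under inclusion. A congruence $\theta$ of $\boldsymbol{A}$ is compatible with $F\subseteq A$ if $F$ is a union of $\theta$-classes; $\Omega^{\boldsymbol{A}}F$ is the largest congruence of $\boldsymbol{A}$ compatible with $F$. For a quasivariety $\mathsf{K}$, the $\mathsf{K}$-congruences of $\boldsymbol{A}$ are the congruences $\theta$ with $\boldsymbol{A}/\theta\in\mathsf{K}$; they form an algebraic lattice under inclusion. $\vdash$ is algebraized by $\mathsf{K}$ if, for every algebra $\boldsymbol{A}$, the map $F\mapsto\Omega^{\boldsymbol{A}}F$ is an isomorphism from the lattice of $\vdash$-filters of $\boldsymbol{A}$ onto the lattice of $\mathsf{K}$-congruences of $\boldsymbol{A}$. $\mathsf{K}_{\mathrm{RSI}}$ [resp. $\mathsf{K}_{\mathrm{RFSI}}$] is the class of all $\boldsymbol{A}\in\mathsf{K}$ whose identity relation $\{\langle a,a\rangle:a\in A\}$ is completely meet-irreducible [resp. meet-irreducible] in the lattice of $\mathsf{K}$-congruences of $\boldsymbol{A}$. (The top of a complete lattice is not completely meet-irreducible, being the meet of $\emptyset$, so members of $\mathsf{K}_{\mathrm{RSI}}$ are nontrivial; the top does count as meet-irreducible.) An algebra is trivial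 if it has one element. A $\mathsf{K}$-congruence (resp. $\vdash$-filter) of $\boldsymbol{A}$ is proper if it differs from $A\times A$ (resp. $A$). *)

(* Defs.v *)
From Stdlib Require List.
From mathcomp Require Import all_boot all_classical.

Set Implicit Arguments.
Unset Strict Implicit.
Unset Printing Implicit Defensive.

Local Open Scope classical_set_scope.

(* An algebraic signature together with an infinite set of variables, in which
   a sequence of distinct variables is fixed. The sequence is indexed from 0:
   [v i] is the variable written v_{i+1} in the usual 1-based notation. *)
Record language := Language {
  symbol : Type;
  arity : symbol -> nat;
  variable : Type;
  v : nat -> variable;
  v_inj : injective v }.

Inductive Fm (L : language) : Type :=
| Var (x : variable L)
| App (f : symbol L) (ts : 'I_(arity f) -> Fm L).
Arguments Var {L} x.
Arguments App {L} f ts.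

Record algebra (L : language) := Algebra {
  carrier :> Type;
  interp : forall f : symbol L, ('I_(arity f) -> carrier) -> carrier;
  nonempty : inhabited carrier }.
Arguments interp {L} a f _.

Definition FmAlg (L : language) : algebra L :=
  @Algebra L (Fm L) (@App L) (inhabits (Var (v L 0))).

Definition is_hom (L : language) (A B : algebra L) (h : A -> B) : Prop :=
  forall (f : symbol L) (a : 'I_(arity f) -> A),
    h (interp A f a) = interp B f (h \o a).

(* The homomorphism Fm -> A extending an assignment of the variables. *)
Fixpoint eval (L : language) (A : algebra L) (e : variable L -> A) (t : Fm L)
    : A :=
  match t with
  | Var x => e x
  | App f ts => interp A f (fun i => eval e (ts i))
  end.

Fixpoint occurs (L : language) (x : variable L) (t : Fm L) : Prop :=
  match t with
  | Var y => x = y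
  | App f ts => exists i, occurs x (ts i)
  end.

Definition FmN (L : language) (n : nat) : set (Fm L) :=
  [set t | forall x, occurs x t -> exists i : 'I_n, x = v L i].

(* Variables other than v_1, ..., v_n are left unchanged. *)
Definition assign (L : language) (n : nat) (alpha : 'I_n -> Fm L)
    (x : variable L) : Fm L :=
  if [pick i : 'I_n | `[< v L i = x >]] is Some i then alpha i else Var x.

(* Psi(alpha_1, ..., alpha_n) *)
Definition instance (L : language) (n : nat) (Psi : set (Fm L))
    (alpha : 'I_n -> Fm L) : set (Fm L) :=
  @eval L (FmAlg L) (assign alpha) @` Psi.

Record deductive_system (L : language) := DeductiveSystem {
  entails :> set (Fm L) -> Fm L -> Prop;
  entails_refl : forall (Gamma : set (Fm L)) alpha,
    Gamma alpha -> entails Gamma alpha;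
  entails_trans : forall (Gamma Pi : set (Fm L)) beta,
    (forall alpha, Pi alpha -> entails Gamma alpha) -> entails Pi beta ->
    entails Gamma beta;
  entails_finitary : forall (Gamma : set (Fm L)) alpha, entails Gamma alpha ->
    exists Gamma' : set (Fm L),
      [/\ finite_set Gamma', Gamma' `<=` Gamma & entails Gamma' alpha];
  entails_subst : forall (s : FmAlg L -> FmAlg L) (Gamma : set (Fm L)) alpha,
    is_hom s -> entails Gamma alpha -> entails (s @` Gamma) (s alpha) }.

Definition entails_set (L : language) (D : deductive_system L)
    (Gamma Pi : set (Fm L)) : Prop :=
  forall alpha, Pi alpha -> D Gamma alpha.

Definition inconsistent (L : language) (D : deductive_system L)
    (Xi : set (Fm L)) : Prop :=
  forall alpha, D Xi alpha.

(* Psi is indexed by positive integers: [Psi 0] is unconstrained. *)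
Definition elementary_IL_sequence (L : language) (D : deductive_system L)
    (Psi : nat -> set (Fm L)) : Prop :=
  forall n, 0 < n ->
    [/\ finite_set (Psi n), Psi n `<=` FmN n &
      forall (Gamma : set (Fm L)) (alpha : 'I_n -> Fm L),
        inconsistent D (Gamma `|` range alpha) <->
        entails_set D Gamma (instance (Psi n) alpha)].

Definition has_IL (L : language) (D : deductive_system L) : Prop :=
  exists Psi, elementary_IL_sequence D Psi.

Definition enumerates (T : Type) (m : nat) (s : 'I_m -> T) (X : set T) : Prop :=
  injective s /\ range s = X.

(* [m] and [psi] are #n and psi_n^1, ..., psi_n^{#n}. When [Psi n] is empty,
   m = 0 and the premise on [Psi 0] is idle: the other one already reads
   Gamma |- phi. *)
Definition has_WEML (L : language) (D : deductive_system L) : Prop :=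
  exists2 Psi : nat -> set (Fm L), elementary_IL_sequence D Psi &
    forall n, 0 < n ->
    forall (m : nat) (psi : 'I_m -> Fm L), enumerates psi (Psi n) ->
    forall (Gamma : set (Fm L)) (alpha : 'I_n -> Fm L) (phi : Fm L),
      D (Gamma `|` instance (Psi n) alpha) phi ->
      D (Gamma `|` instance (instance (Psi m) psi) alpha) phi ->
      D Gamma phi.

Definition is_filter (L : language) (D : deductive_system L) (A : algebra L)
    (F : set A) : Prop :=
  forall (Gamma : set (Fm L)) (alpha : Fm L), D Gamma alpha ->
  forall h : FmAlg L -> A, is_hom h -> h @` Gamma `<=` F -> F (h alpha).

Definition filters (L : language) (D : deductive_system L) (A : algebra L)
    : set (set A) :=
  [set F | is_filter D F].
Arguments filters {L} D A _.

Definition eqclass (T : Type) (theta : set (T * T)) (a : T) : set T :=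
  [set b | theta (a, b)].

Record is_congruence (L : language) (A : algebra L) (theta : set (A * A))
    : Prop := IsCongruence {
  cong_refl : forall a, theta (a, a);
  cong_sym : forall a b, theta (a, b) -> theta (b, a);
  cong_trans : forall a b c, theta (a, b) -> theta (b, c) -> theta (a, c);
  cong_interp : forall (f : symbol L) (a b : 'I_(arity f) -> A),
    (forall i, theta (a i, b i)) -> theta (interp A f a, interp A f b) }.

Definition compatible (T : Type) (theta : set (T * T)) (F : set T) : Prop :=
  exists B : set T, F = \bigcup_(a in B) eqclass theta a.

Section Quotient.
Variables (L : language) (A : algebra L) (theta : set (A * A)).

Definition quot_carrier : Type :=
  {C : set A | exists a, C = eqclass theta a}.

Definition quot_class (a : A) : quot_carrier :=
  exist _ (eqclass theta a) (ex_intro _ a erefl).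

Definition quot_repr (C : quot_carrier) : A := projT1 (cid (proj2_sig C)).

Lemma quot_nonempty : inhabited quot_carrier.
Proof. by case: (nonempty A) => a; exists; exact: quot_class a. Qed.

(* A / theta. The operations are computed on chosen representatives, which is
   the usual quotient structure when theta is a congruence. *)
Definition quotient : algebra L :=
  @Algebra L quot_carrier
    (fun f C => quot_class (interp A f (quot_repr \o C))) quot_nonempty.

Lemma quot_reprK : cancel quot_repr quot_class.
Proof.
move=> [C hC]; rewrite /quot_repr /=; case: cid => a /= e.
by apply: eq_exist; rewrite e.
Qed.

Lemma quot_class_hom : is_congruence theta -> @is_hom L A quotient quot_class.
Proof.
move=> cth f a; apply: eq_exist; apply/seteqP.
have key i : theta (a i, quot_repr (quot_class (a i))).
  rewrite /quot_repr; case: cid => b /= e.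
  have : eqclass theta b b by rewrite /eqclass /=; exact: cong_refl.
  by rewrite -e.
have h := cong_interp cth key.
split=> b hb; last exact: (cong_trans cth h hb).
exact: (cong_trans cth (cong_sym cth h) hb).
Qed.

End Quotient.

(* The union of all congruences compatible with F; [Omega_largest] below shows
   that it is the largest one. *)
Definition Omega (L : language) (A : algebra L) (F : set A) : set (A * A) :=
  \bigcup_(theta in [set theta | is_congruence theta /\ compatible theta F])
    theta.

(* Quasi-equations: finitely many equations imply an equation. *)
Definition equation (L : language) : Type := (Fm L * Fm L)%type.
Definition quasi_equation (L : language) : Type :=
  (seq (equation L) * equation L)%type.

Definition holds_eq (L : language) (A : algebra L) (e : variable L -> A)
    (E : equation L) : Prop :=
  eval e E.1 = eval e E.2.

Definition satisfies (L : language) (A : algebra L) (q : quasi_equation L)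
    : Prop :=
  forall e : variable L -> A,
    (forall E, List.In E q.1 -> holds_eq e E) -> holds_eq e q.2.

Definition is_quasivariety (L : language) (K : algebra L -> Prop) : Prop :=
  exists Q : set (quasi_equation L),
    forall A : algebra L, K A <-> forall q, Q q -> satisfies A q.

Definition Kcongruences (L : language) (K : algebra L -> Prop) (A : algebra L)
    : set (set (A * A)) :=
  [set theta | is_congruence theta /\ K (quotient theta)].
Arguments Kcongruences {L} K A _.

(* In what follows a set [X] of subsets of T is a lattice under inclusion. *)

Definition order_isomorphism (T U : Type) (X : set (set T)) (Y : set (set U))
    (g : set T -> set U) : Prop :=
  set_bij X Y g /\
  forall F G, X F -> X G -> (F `<=` G <-> g F `<=` g G).

Definition is_meet (T : Type) (X S : set (set T)) (x : set T) : Prop :=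
  [/\ X x, forall y, S y -> x `<=` y &
    forall z, X z -> (forall y, S y -> z `<=` y) -> z `<=` x].

Definition completely_meet_irreducible (T : Type) (X : set (set T))
    (x : set T) : Prop :=
  X x /\ forall S, S `<=` X -> is_meet X S x -> S x.

Definition meet_irreducible (T : Type) (X : set (set T)) (x : set T) : Prop :=
  X x /\ forall y z, X y -> X z -> is_meet X [set y; z] x -> x = y \/ x = z.

Definition has_greatest_proper (T : Type) (X : set (set T)) : Prop :=
  exists x, [/\ X x, x <> setT & forall y, X y -> y <> setT -> y `<=` x].

Definition algebraizes (L : language) (K : algebra L -> Prop)
    (D : deductive_system L) : Prop :=
  forall A : algebra L,
    order_isomorphism (filters D A) (Kcongruences K A) (@Omega L A).

Definition identity_relation (T : Type) : set (T * T) :=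
  [set p | p.1 = p.2].
Arguments identity_relation : clear implicits.

Definition RSI (L : language) (K : algebra L -> Prop) : algebra L -> Prop :=
  fun A => K A /\ completely_meet_irreducible (Kcongruences K A)
                    (identity_relation A).

Definition RFSI (L : language) (K : algebra L -> Prop) : algebra L -> Prop :=
  fun A => K A /\ meet_irreducible (Kcongruences K A) (identity_relation A).

Definition trivial (L : language) (A : algebra L) : Prop :=
  exists a : A, forall b : A, b = a.

Section OmegaLargest.
Variables (L : language) (A : algebra L) (F : set A).

Lemma compatibleP (theta : set (A * A)) : is_congruence theta ->
  compatible theta F <-> forall a b, theta (a, b) -> F a -> F b.
Proof.
move=> cth; split=> [[B ->] a b tab [c Bc tca]|sat].
  by exists c => //; exact: (cong_trans cth tca tab).
exists F; apply/seteqP; split=> [a Fa|b [a Fa tab]]; last exact: sat tab Fa.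
by exists a => //; exact: cong_refl.
Qed.

Inductive chain : A -> A -> Prop :=
| chain0 a : chain a a
| chainS a b c : Omega F (a, b) -> chain b c -> chain a c.

Lemma chain_trans a b c : chain a b -> chain b c -> chain a c.
Proof. by elim=> // x y z xy _ ih /ih; exact: chainS. Qed.

Lemma Omega_sym a b : Omega F (a, b) -> Omega F (b, a).
Proof. by move=> [th cth tab]; exists th => //; apply: cong_sym tab; case: cth. Qed.

Lemma chain_sym a b : chain a b -> chain b a.
Proof.
elim=> [x|x y z xy _ ih]; first exact: chain0.
by apply: chain_trans ih _; apply: chainS (Omega_sym xy) (chain0 _).
Qed.

Lemma chain_interp (f : symbol L) (a b : 'I_(arity f) -> A) :
  (forall i, chain (a i) (b i)) -> chain (interp A f a) (interp A f b).
Proof.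
move=> ab; pose mix k := fun i : 'I_(arity f) => if i < k then b i else a i.
suff H k : chain (interp A f a) (interp A f (mix k)).
  have -> : b = mix (arity f) by apply: funext => i; rewrite /mix ltn_ord.
  exact: H.
elim: k => [|k ih]; first exact: chain0.
apply: chain_trans ih _.
case: (ltnP k (arity f)) => [lt|ge]; last first.
  suff -> : mix k.+1 = mix k by exact: chain0.
  apply: funext => i; rewrite /mix.
  have ik := leq_trans (ltn_ord i) ge.
  by rewrite ik ltnS (ltnW ik).
pose j := Ordinal lt.
pose upd x := fun i : 'I_(arity f) => if i == j then x else mix k i.
have -> : mix k = upd (a j).
  by apply: funext => i; rewrite /upd; case: eqP => // ->; rewrite /mix ltnn.
have -> : mix k.+1 = upd (b j).
  apply: funext => i; rewrite /upd; case: eqP => [->|/eqP ne].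
    by rewrite /mix ltnSn.
  by rewrite /mix ltnS leq_eqVlt -[_ == k :> nat]/(i == j) (negbTE ne).
elim: (ab j) => [x|x y z [th cth txy] _ ih]; first exact: chain0.
apply: chainS ih; exists th => //; case: cth => cth _.
by apply: cong_interp => // i; rewrite /upd; case: eqP => // _; exact: cong_refl.
Qed.

Lemma Omega_largest :
  [/\ is_congruence (Omega F), compatible (Omega F) F &
    forall theta, is_congruence theta -> compatible theta F ->
      theta `<=` Omega F].
Proof.
pose J : set (A * A) := [set p | chain p.1 p.2].
have cJ : is_congruence J.
  split; [exact: chain0|exact: chain_sym| |exact: chain_interp].
  by move=> a b c; exact: chain_trans.
have JF : compatible J F.
  apply/compatibleP => // a b; rewrite /J /=; elim=> // x y z [th [cth hth] txy].
  by move=> _ ih Fx; apply: ih; move/(compatibleP cth): hth; apply; [exact: txy|].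
have OJ : Omega F = J.
  apply/seteqP; split=> [[a b] ab|p Jp]; last by exists J.
  exact: chainS ab (chain0 _).
by rewrite {1 2}OJ; split=> // th cth hth p thp; exists th.
Qed.

End OmegaLargest.

(* Main.v *)
Require Import Defs.
From mathcomp Require Import all_boot all_classical.

Set Implicit Arguments.
Unset Strict Implicit.
Unset Printing Implicit Defensive.

Local Open Scope classical_set_scope.

(** Algebraization matches the filters of an algebra with its relative congruences,
so the theorem can be read in terms of filters.

From the law to greatest proper filters ([WEML_greatest_proper]).  In a
relatively finitely subdirectly irreducible algebra, the least filter is
meet-irreducible ([meet_irreducible_least_filter]).  A maximal proper filter
exists, because some finite set generates the improper filter
([exists_improper_finite], [maximal_filter_omitting]).  If it missed a proper
filter, the two would have an improper join; the inconsistency lemma would then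
put a tuple [a] into one of them and [Psi n] of [a] into the other, whereas the
law and meet-irreducibility force one of these two filters to contain a tuple
together with its own inconsistency witness, which makes it improper
([filter_improper]).

This argument needs the inconsistency lemma and the law inside arbitrary
algebras, which may have more elements than there are formulas.  The transfer
from formulas is [fgen_derivable]: an element belongs to a generated filter only
if the formulas naming it are derivable from those naming the generators, for
every evaluation that names enough elements.  Countably many names suffice, which
is why one fixed sequence of variables is enough.  Algebraizability enters
through [kernel_saturated]: as [Omega] is monotone, a theory that contains the
preimage of a filter cannot distinguish two names of one element.

From the relatively subdirectly irreducible algebras back to the law
([greatest_proper_WEML]).  A counterexample to the law yields a theory [T]
maximal among those that omit its conclusion; the quotient of the formula algebra
by [Omega T] is relatively subdirectly irreducible ([maximal_omitting_RSI]), and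
its greatest proper congruence corresponds to a greatest consistent theory above
[T] ([greatest_proper_above]).  That theory contains both [alpha] and [Psi n] of
[alpha], a contradiction. *)

(** * Finite and countable sets *)

Lemma countable_image (T U : Type) (f : T -> U) (X : set T) :
  countable X -> countable (f @` X).
Proof. exact/sub_countable/card_image_le. Qed.

Lemma countableU (T : Type) (X Y : set T) :
  countable X -> countable Y -> countable (X `|` Y).
Proof.
by move=> cX cY; rewrite -bigcup2E; apply: bigcup_countable => // -[|[|i]] _.
Qed.

Lemma finite_enumerates (T : Type) (X : set T) :
  finite_set X -> exists m (s : 'I_m -> T), enumerates s X.
Proof.
move=> /(@finite_seqP {classic T})[s ->].
pose t := in_tuple (undup s).
have tinj : injective (tnth t) by apply/tuple_uniqP; rewrite undup_uniq.
exists (size (undup s)), (tnth t); split=> //.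
apply/seteqP; split=> [x [i _ <-]|x /=]; first by rewrite /= -mem_undup mem_tnth.
by rewrite -mem_undup => /(tnthP t)[i ->]; exists i.
Qed.

Lemma finite_sub_chain (T : Type) (C : set (set T)) (X : set T) :
  C !=set0 -> total_on C subset -> finite_set X ->
  X `<=` \bigcup_(H in C) H -> exists2 H, C H & X `<=` H.
Proof.
move=> [H0 CH0] tot /(@finite_seqP {classic T})[s ->].
elim: s => [|x s ih] sub; first by exists H0.
have [|H CH sH] := ih.
  by move=> y /= ys; apply: sub; rewrite /= in_cons ys orbT.
have [|H' CH' H'x] := sub x; first by rewrite /= mem_head.
have [HH'|H'H] := tot _ _ CH CH'.
  by exists H' => // y /=; rewrite in_cons => /orP[/eqP->//|/sH/HH'].
by exists H => // y /=; rewrite in_cons => /orP[/eqP->|/sH//]; exact: H'H.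
Qed.

(** * Evaluation of formulas *)

Section Evaluation.
Variable L : language.
Implicit Types (A B : algebra L) (t : Fm L).

Lemma is_hom_comp A B (C : algebra L) (g : B -> C) (h : A -> B) :
  is_hom g -> is_hom h -> is_hom (g \o h).
Proof. by move=> hg hh f a; rewrite /= hh hg. Qed.

Lemma eval_local A (e e' : variable L -> A) t :
  (forall x, occurs x t -> e x = e' x) -> eval e t = eval e' t.
Proof.
elim: t => [x|f ts ih] /= H; first exact: H.
by congr (interp A f); apply: funext => i; apply: ih => x ox; apply: H; exists i.
Qed.

Lemma hom_eval A B (k : A -> B) (s : variable L -> A) t :
  is_hom k -> k (eval s t) = eval (k \o s) t.
Proof.
move=> hk; elim: t => [//|f ts ih] /=; rewrite hk.
by congr (interp B f); apply: funext => i; rewrite /= ih.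
Qed.

Lemma eval_Var t : @eval L (FmAlg L) Var t = t.
Proof. by elim: t => [//|f ts ih] /=; congr App; apply: funext => i. Qed.

Lemma hom_is_eval A (k : FmAlg L -> A) t : is_hom k -> k t = eval (k \o Var) t.
Proof. by move=> hk; rewrite -hom_eval // eval_Var. Qed.

Lemma occurs_eval (s : variable L -> FmAlg L) x t :
  occurs x (eval s t) -> exists2 y, occurs y t & occurs x (s y).
Proof.
elim: t => [y|f ts ih] /=; first by exists y.
by move=> [i /ih[y yt xy]]; exists y => //; exists i.
Qed.

Lemma countable_occurs t : countable [set x | occurs x t].
Proof.
elim: t => [y|f ts ih] /=.
  exact/finite_set_countable/finite_set1.
have -> : [set x | exists i, occurs x (ts i)]
    = \bigcup_(i in [set: 'I_(arity f)]) [set x | occurs x (ts i)].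
  by apply/seteqP; split=> [x [i ?]|x [i _ ?]]; exists i.
by apply: bigcup_countable => [|i _]; [exact: countableP|exact: ih].
Qed.

(** The fixed sequence of variables is infinite, so it can enumerate [S]. *)
Lemma exists_covering A (S : set A) :
  countable S -> exists e : variable L -> A, S `<=` range e.
Proof.
move=> /countable_injP[f finj]; have [a0] := Defs.nonempty A.
pose P x a := S a /\ v L (f a) = x.
exists (fun x => if pselect (exists a, P x a) is left h then projT1 (cid h)
                 else a0) => a Sa.
exists (v L (f a)) => //; case: pselect => [h|]; last by case; exists a.
by case: cid => b /= [Sb /v_inj]; apply: finj; apply/mem_set.
Qed.

(** Each variable is renamed to one whose value under [e] is the value that [g]
prescribes; this carries a deduction evaluated by [g] over to [e]. *)
Lemma exists_lift A (e g : variable L -> A) :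
  exists s : variable L -> FmAlg L, forall t,
    g @` [set x | occurs x t] `<=` range e -> eval e (eval s t) = eval g t.
Proof.
pose P x y := e y = g x.
exists (fun x => if pselect (exists y, P x y) is left h
                 then Var (projT1 (cid h)) else Var x) => t cov.
rewrite hom_eval //; apply: eval_local => x xt /=.
case: pselect => [h|]; first by case: cid.
by case; have [|y _ ?] := cov (g x); [exists x|exists y].
Qed.

(** The value of [Psi] at a tuple of elements of an arbitrary algebra. For
[Psi] in the first n variables all the assignments in the union give the same
set. *)
Definition instance_in A (n : nat) (Psi : set (Fm L)) (a : 'I_n -> A) : set A :=
  \bigcup_(e in [set e : variable L -> A | forall i : 'I_n, e (v L i) = a i])
    (eval e @` Psi).

Lemma exists_assignment A n (a : 'I_n -> A) (b : A) (j : nat) : n <= j ->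
  exists e : variable L -> A, (forall i : 'I_n, e (v L i) = a i) /\ e (v L j) = b.
Proof.
move=> nj.
exists (fun x => if [pick i : 'I_n | `[< v L i = x >]] is Some i then a i else b).
split=> [i|].
  case: pickP => [i' /asboolP/v_inj/val_inj->//|/(_ i)/negbT/asboolPn].
  by case.
case: pickP => // i /asboolP/v_inj ij; move: (ltn_ord i).
by rewrite ij ltnNge nj.
Qed.

Lemma instance_in_eval A n (Psi : set (Fm L)) (a : 'I_n -> A)
    (e : variable L -> A) :
  Psi `<=` FmN n -> (forall i : 'I_n, e (v L i) = a i) ->
  instance_in Psi a = eval e @` Psi.
Proof.
move=> PsiN ea; apply/seteqP; split=> [b [e' e'a [t Pt <-]]|b bP].
  exists t => //; apply: eval_local => x /(PsiN _ Pt)[i ->].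
  by rewrite ea e'a.
by exists e.
Qed.

Lemma assignE n (alpha : 'I_n -> Fm L) (i : 'I_n) : assign alpha (v L i) = alpha i.
Proof.
rewrite /assign; case: pickP => [j /asboolP/v_inj/val_inj->//|/(_ i)/negbT].
by move=> /asboolPn; case.
Qed.

Lemma image_instance A n (Psi : set (Fm L)) (alpha : 'I_n -> Fm L)
    (k : FmAlg L -> A) :
  Psi `<=` FmN n -> is_hom k ->
  k @` instance Psi alpha = instance_in Psi (k \o alpha).
Proof.
move=> PsiN hk; rewrite (@instance_in_eval _ _ _ _ (k \o assign alpha)) //.
  rewrite /instance image_comp; apply: eq_imagel => t _ /=.
  by rewrite hom_eval.
by move=> i; rewrite /= assignE.
Qed.

Lemma instanceE n (Psi : set (Fm L)) (alpha : 'I_n -> Fm L) :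
  Psi `<=` FmN n -> instance Psi alpha = @instance_in (FmAlg L) n Psi alpha.
Proof.
move=> PsiN; rewrite (@instance_in_eval (FmAlg L) _ _ _ (assign alpha)) // => i.
exact: assignE.
Qed.

Lemma instance_FmN n m (Psi : set (Fm L)) (alpha : 'I_m -> Fm L) :
  Psi `<=` FmN m -> (forall i, FmN n (alpha i)) ->
  instance Psi alpha `<=` FmN n.
Proof.
move=> PsiN aN _ [t Pt <-] x /occurs_eval[y yt].
by have [i ->] := PsiN _ Pt _ yt; rewrite assignE; exact: aN.
Qed.

Lemma instance_instance n m (Psi : set (Fm L)) (psi : 'I_m -> Fm L)
    (alpha : 'I_n -> Fm L) : Psi `<=` FmN m ->
  instance (instance Psi psi) alpha
  = instance Psi (@eval L (FmAlg L) (assign alpha) \o psi).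
Proof. by move=> PsiN; rewrite [RHS]instanceE // -image_instance. Qed.

End Evaluation.

(** * Filters *)

Section Filters.
Variables (L : language) (D : deductive_system L).
Implicit Types (A B : algebra L).

Lemma entails_mono (X Y : set (Fm L)) phi : X `<=` Y -> D X phi -> D Y phi.
Proof. by move=> XY; apply: entails_trans => alpha /XY; exact: entails_refl. Qed.

Lemma entails_set_finitary (X Z : set (Fm L)) : finite_set Z ->
  entails_set D X Z ->
  exists X', [/\ finite_set X', X' `<=` X & entails_set D X' Z].
Proof.
move=> finZ XZ.
have /choice[W hW] : forall z, exists W, Z z ->
    [/\ finite_set W, W `<=` X & D W z].
  move=> z; have [Zz|nZz] := pselect (Z z); last by exists set0.
  by have [W ?] := entails_finitary (XZ _ Zz); exists W.
exists (\bigcup_(z in Z) W z); split.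
- by apply: bigcup_finite => // z /hW[].
- by move=> x [z /hW[_ WX _] /WX].
- by move=> z Zz; have [_ _] := hW _ Zz; apply: entails_mono => x; exists z.
Qed.

Lemma finitary_is_filter A (F : set A) :
  (forall (X : set (Fm L)) phi (e : variable L -> A), finite_set X ->
    D X phi -> (forall t, X t -> F (eval e t)) -> F (eval e phi)) ->
  is_filter D F.
Proof.
move=> H X phi Xphi k hk kX; have [X' [finX' X'X X'phi]] := entails_finitary Xphi.
rewrite (hom_is_eval phi hk); apply: H X'phi _ => // t /X'X Xt.
by rewrite -hom_is_eval //; apply: kX; exists t.
Qed.

Lemma theory_is_filter (X : set (Fm L)) : @is_filter L D (FmAlg L) (D X).
Proof.
move=> Y phi Yphi s hs sY; apply: entails_trans (entails_subst hs Yphi).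
exact: sY.
Qed.

Lemma filter_is_theory (T : set (FmAlg L)) (X : set (Fm L)) phi :
  is_filter D T -> X `<=` T -> D X phi -> T phi.
Proof.
move=> fT XT Xphi; apply: (fT _ _ Xphi id) => // _ [t Xt <-]; exact: XT.
Qed.

Lemma filter_eval A (F : set A) (e : variable L -> A) (X : set (Fm L)) phi :
  is_filter D F -> D X phi -> (forall t, X t -> F (eval e t)) ->
  F (eval e phi).
Proof.
by move=> fF Xphi eX; apply: (fF _ _ Xphi (eval e)) => // _ [t /eX Ft <-].
Qed.

Lemma setT_is_filter A : is_filter D [set: A].
Proof. by []. Qed.

Lemma filter_preimage A B (k : B -> A) (F : set A) :
  is_hom k -> is_filter D F -> is_filter D (k @^-1` F).
Proof.
move=> hk fF X phi Xphi h hh hX; apply: (fF X phi Xphi (k \o h)).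
  exact: is_hom_comp.
by move=> _ [t Xt <-] /=; apply: hX; exists t.
Qed.

Definition fgen A (X : set A) : set A :=
  [set b | forall G, is_filter D G -> X `<=` G -> G b].

Lemma fgen_filter A (X : set A) : is_filter D (fgen X).
Proof.
move=> Y phi Yphi k hk kY G fG XG; apply: (fG _ _ Yphi _ hk) => b /kY kb.
exact: (kb G fG XG).
Qed.

Lemma sub_fgen A (X : set A) : X `<=` fgen X.
Proof. by move=> b Xb G _ XG; exact: XG. Qed.

Lemma fgen_min A (X G : set A) : is_filter D G -> X `<=` G -> fgen X `<=` G.
Proof. by move=> fG XG b gb; exact: (gb G fG XG). Qed.

(** Zorn's lemma applies because deductions are finitary, so that unions of
chains of filters are filters, and because a finite set included in the union
of a chain is included in one of its members. *)
Lemma maximal_filter_omitting A (X F : set A) :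
  finite_set X -> is_filter D F -> ~ X `<=` F ->
  exists M, [/\ is_filter D M, F `<=` M, ~ X `<=` M &
    forall H, is_filter D H -> M `<=` H -> ~ X `<=` H -> H `<=` M].
Proof.
move=> finX fF nXF.
(* The union with F makes the empty chain harmless. *)
pose P H := is_filter D (F `|` H) /\ ~ X `<=` F `|` H.
have [C CP tot|M [[fM nXM] maxM]] := @Zorn_bigcup A P.
  pose C' := [set F] `|` [set F `|` H | H in C].
  have UE : F `|` \bigcup_(H in C) H = \bigcup_(H in C') H.
    apply/seteqP; split=> [b [Fb|[H CH Hb]]|b [H [->|[H' CH' <-]]]].
    - by exists F => //; left.
    - by exists (F `|` H); [right; exists H|right].
    - by left.
    - by move=> [Fb|H'b]; [left|right; exists H'].
  have C'P H : C' H -> is_filter D H /\ ~ X `<=` H.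
    by move=> [->//|[H' /CP PH' <-]].
  have C'0 : C' !=set0 by exists F; left.
  have tot' : total_on C' subset.
    move=> _ _ [->|[H CH <-]] [->|[H' CH' <-]].
    - by left.
    - by left; exact: subsetUl.
    - by right; exact: subsetUl.
    - by have [HH'|H'H] := tot _ _ CH CH'; [left|right]; exact: setUS.
  split; rewrite UE.
    apply: finitary_is_filter => Y phi e finY Yphi eY.
    have [|H C'H YH] := finite_sub_chain C'0 tot' (finite_image (eval e) finY).
      by move=> _ [t Yt <-]; exact: eY.
    exists H => //; have [fH _] := C'P _ C'H.
    by apply: filter_eval fH Yphi _ => t Yt; apply: YH; exists t.
  move=> /(finite_sub_chain C'0 tot' finX)[H C'H XH].
  by have [_] := C'P _ C'H.
exists (F `|` M); split=> // H fH FMH nXH b Hb; right.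
apply: contrapT => nMb; apply: (maxM H).
  split=> [c Mc|HM]; first by apply: FMH; right.
  exact/nMb/HM.
have HE : F `|` H = H by apply/setUidPr => c Fc; apply: FMH; left.
by rewrite /P HE.
Qed.

End Filters.

(** * Inconsistency in arbitrary algebras *)

Section Improper.
Variables (L : language) (D : deductive_system L) (Psi : nat -> set (Fm L)).
Hypothesis IL : elementary_IL_sequence D Psi.
Implicit Types A : algebra L.

Lemma IL_FmN n : 0 < n -> Psi n `<=` FmN n.
Proof. by move=> /IL[]. Qed.

Lemma IL_inconsistent n (alpha : 'I_n -> Fm L) : 0 < n ->
  inconsistent D (instance (Psi n) alpha `|` range alpha).
Proof.
by move=> /IL[_ _ ILn]; apply/ILn => phi; exact: entails_refl.
Qed.

(** A variable outside the first n is derivable from the inconsistent set made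
of the first n variables and [Psi n], and may be evaluated anywhere. *)
Lemma filter_improper A n (a : 'I_n -> A) (G : set A) : 0 < n ->
  is_filter D G -> range a `<=` G -> instance_in (Psi n) a `<=` G ->
  G = [set: A].
Proof.
move=> n0 fG aG PG; apply/seteqP; split=> // b _.
have [e [ea eb]] := exists_assignment a b (leqnn n).
pose w (i : 'I_n) := Var (v L i).
have wbot := @IL_inconsistent n w n0.
rewrite -eb; apply: (fG _ _ (wbot (Var (v L n))) (eval e)) => //.
move=> _ [t [wt|[i _ <-]] <-].
  apply: PG; have <- : (eval e : FmAlg L -> A) \o w = a by exact: funext.
  by rewrite -image_instance //; exact: IL_FmN.
by apply: aG; exists i => //=; rewrite ea.
Qed.

Lemma exists_improper_finite A : exists X : set A, finite_set X /\
  forall G, is_filter D G -> X `<=` G -> G = [set: A].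
Proof.
have [b] := Defs.nonempty A; pose c (i : 'I_1) := b.
exists ([set b] `|` instance_in (Psi 1) c); split.
  rewrite finite_setU; split; first exact: finite_set1.
  have [finPsi PsiN _] := IL (ltn0Sn 0).
  by rewrite (@instance_in_eval _ _ _ _ _ (fun=> b)) //; exact: finite_image.
move=> G fG XG; apply: (@filter_improper _ 1 c) => //.
- by move=> _ [i _ <-]; apply: XG; left.
- by move=> d hd; apply: XG; right.
Qed.

End Improper.

(** * Transfer from formulas to arbitrary algebras *)

Section Transfer.
Variables (L : language) (D : deductive_system L) (K : algebra L -> Prop).
Hypothesis KD : algebraizes K D.
Implicit Types (A B : algebra L).

Lemma Omega_mono A (F G : set A) : is_filter D F -> is_filter D G ->
  F `<=` G <-> Omega F `<=` Omega G.
Proof. by move=> fF fG; have [_] := KD A; apply. Qed.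

Lemma kernel_congruence A B (k : B -> A) : is_hom k ->
  @is_congruence L B [set p | k p.1 = k p.2].
Proof.
move=> hk; split=> //= [a b c -> //|f a b ab].
by rewrite !hk; congr interp; exact: funext.
Qed.

(** The kernel of [k] is compatible with the preimage of [F], and monotonicity of
[Omega] passes this compatibility on to every larger filter. *)
Lemma kernel_saturated A B (k : B -> A) (F : set A) (H : set B) b b' :
  is_hom k -> is_filter D F -> is_filter D H -> k @^-1` F `<=` H ->
  k b = k b' -> H b -> H b'.
Proof.
move=> hk fF fH FH kbb'.
have cker := kernel_congruence hk.
have [cO cOH _] := Omega_largest H; move/(compatibleP _ cO): cOH; apply.
apply: (Omega_mono (filter_preimage hk fF) fH).1 FH _ _.
have [_ _] := Omega_largest (k @^-1` F); apply; [exact: cker| |exact: kbb'].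
by apply/(compatibleP _ cker) => c d /= ->.
Qed.

(** Membership in a generated filter of an arbitrary algebra amounts to
derivability between formulas, provided that formulas are evaluated so that
enough elements get a name.  The elements with this property form a filter: the
countable sets required by the premises of a rule can be united, the rule can then
be carried out on names, and by [kernel_saturated] the name that it produces for
the conclusion may be exchanged for any other. *)
Lemma fgen_derivable A (F Y : set A) b :
  is_filter D F -> fgen D (F `|` Y) b ->
  exists S : set A, countable S /\
    forall e : variable L -> A, S `<=` range e ->
    forall beta, eval e beta = b -> D (eval e @^-1` (F `|` Y)) beta.
Proof.
move=> fF; pose G c := exists S : set A, countable S /\
  forall e : variable L -> A, S `<=` range e ->
  forall beta, eval e beta = c -> D (eval e @^-1` (F `|` Y)) beta.
suff [fG FG] : is_filter D G /\ F `|` Y `<=` G by move/(_ G fG FG).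
split; last first.
  move=> c Fc; exists set0; split=> // e _ beta ebeta.
  by apply: entails_refl; rewrite /preimage /= ebeta.
apply: finitary_is_filter => X phi g finX Xphi gX.
have /choice[S hS] : forall t, exists S : set A, X t -> countable S /\
    forall e : variable L -> A, S `<=` range e ->
    forall beta, eval e beta = eval g t -> D (eval e @^-1` (F `|` Y)) beta.
  move=> t; have [/gX[S hS]|nXt] := pselect (X t); last by exists set0.
  by exists S.
pose vals t := g @` [set x | occurs x t].
have cvals t : countable (vals t) by exact/countable_image/countable_occurs.
(* Besides what the premises require, the values of the variables of the rule
   need names, so that the rule itself can be renamed. *)
exists (vals phi `|` \bigcup_(t in X) (vals t `|` S t)); split.
  apply: countableU; first exact: cvals.
  apply: bigcup_countable => [|t /hS[cS _]]; first exact: finite_set_countable.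
  by apply: countableU; first exact: cvals.
move=> e cov beta ebeta.
have [s hs] := exists_lift e g.
have esphi : eval e (eval s phi) = eval g phi.
  by apply: hs => a ha; apply: cov; left.
apply: (@kernel_saturated A (FmAlg L) (eval e) F (D (eval e @^-1` (F `|` Y)))
  (eval s phi)) => //.
- exact: theory_is_filter.
- by move=> t Ft; apply: entails_refl; left.
- by rewrite esphi ebeta.
have sX : D (eval s @` X) (eval s phi).
  exact: (@entails_subst _ _ (eval s : FmAlg L -> FmAlg L)).
apply: entails_trans sX => _ [t Xt <-].
have [_] := hS t Xt; apply.
  by move=> a Sa; apply: cov; right; exists t => //; right.
by apply: hs => a ha; apply: cov; right; exists t => //; left.
Qed.

(** The join is improper as soon as it contains [b] and [Psi 1] of [b], a finite
set.  Deriving names of its members takes finitely many premises; those named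
in [F] give the tuple, and the others are absorbed by [G]. *)
Lemma improper_join_instance Psi A (F G : set A) :
  elementary_IL_sequence D Psi -> is_filter D G -> G <> [set: A] ->
  fgen D (G `|` F) = [set: A] ->
  exists n (a : 'I_n -> A),
    [/\ 0 < n, range a `<=` F & instance_in (Psi n) a `<=` G].
Proof.
move=> IL fG Gproper GF.
have [b] := Defs.nonempty A.
have [finPsi PsiN _] := IL 1 (ltn0Sn 0).
have /choice[S hS] : forall c, exists S : set A, countable S /\
    forall e : variable L -> A, S `<=` range e ->
    forall beta, eval e beta = c -> D (eval e @^-1` (G `|` F)) beta.
  by move=> c; apply: fgen_derivable; rewrite // GF.
have [|e cov] := @exists_covering _ A
    ([set b] `|` S b `|` \bigcup_(t in Psi 1) S (eval (fun=> b) t)).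
  apply: countableU; first apply: countableU.
  - exact/finite_set_countable/finite_set1.
  - by have [] := hS b.
  - apply: bigcup_countable => [|t _]; first exact: finite_set_countable.
    by have [] := hS (eval (fun=> b) t).
have [x _ exb] : range e b by apply: cov; left; left.
pose X := eval e @^-1` (G `|` F).
pose z (i : 'I_1) : Fm L := Var x.
have XZ : entails_set D X (instance (Psi 1) z `|` range z).
  move=> _ [[t Pt <-]|[i _ <-]]; last first.
    have [_] := hS b; apply; last exact: exb.
    by move=> c hc; apply: cov; left; right.
  have [_] := hS (eval (fun=> b) t); apply.
    by move=> c hc; apply: cov; right; exists t.
  rewrite (@hom_eval _ (FmAlg L)) //; apply: eval_local => y /(PsiN _ Pt)[i ->].
  by rewrite /= assignE.
have [|X' [finX' X'X X'Z]] := entails_set_finitary _ XZ.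
  by rewrite finite_setU; split; exact: finite_image.
have X'bot : inconsistent D X'.
  by move=> phi; apply: entails_trans X'Z _; exact: IL_inconsistent.
have [|n [alpha [_ ralpha]]] := @finite_enumerates _ (X' `&` eval e @^-1` F).
  exact: finite_setIl.
have X'T : X' `<=` eval e @^-1` G `|` range alpha.
  by move=> t X't; have [] := X'X t X't; [left|right; rewrite ralpha].
(* With no premise named in F, the filter G alone would be improper. *)
have [n0|n_gt0] := posnP n.
  case: Gproper; apply: (@filter_improper _ D Psi IL A 1 (fun=> b)) => //.
    move=> _ [i _ <-]; rewrite -exb.
    apply: (filter_eval (phi := Var x) fG (X'bot _)).
    by move=> t /X'T[//|[i' _ _]]; case: i'; rewrite n0.
  have -> : (fun=> b) = (eval e : FmAlg L -> A) \o z by exact: funext.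
  rewrite -image_instance // => _ [t Pt <-]; apply: (filter_eval fG (X'bot t)).
  by move=> t' /X'T[//|[i' _ _]]; case: i'; rewrite n0.
exists n, ((eval e : FmAlg L -> A) \o alpha); split=> //.
  by move=> _ [i _ <-]; have : range alpha (alpha i) by []; rewrite ralpha => -[].
rewrite -image_instance //; last exact: (IL_FmN IL).
have [_ _ ILn] := IL n n_gt0.
have Galpha : entails_set D (eval e @^-1` G) (instance (Psi n) alpha).
  by apply/ILn => phi; exact: entails_mono (X'bot phi).
by move=> _ [t /Galpha Gt <-]; exact: filter_eval fG Gt _.
Qed.

(** A law that holds between formulas passes to filters, because one evaluation
can name at once everything that the two generated filters require; the law is
then applied with the formulas valued in [F] as side premises. *)
Lemma WEML_filter A n (Phi Phi' : set (Fm L)) (a : 'I_n -> A) (F : set A) p :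
  Phi `<=` FmN n -> Phi' `<=` FmN n ->
  (forall (Gamma : set (Fm L)) (alpha : 'I_n -> Fm L) phi,
    D (Gamma `|` instance Phi alpha) phi ->
    D (Gamma `|` instance Phi' alpha) phi -> D Gamma phi) ->
  is_filter D F ->
  fgen D (F `|` instance_in Phi a) p -> fgen D (F `|` instance_in Phi' a) p ->
  F p.
Proof.
move=> PhiN PhiN' law fF.
move=> /(fgen_derivable fF)[S [cS hS]] /(fgen_derivable fF)[S' [cS' hS']].
have [|e cov] := @exists_covering _ A ([set p] `|` range a `|` S `|` S').
  do 2?[apply: countableU => //].
  apply: countableU; first exact/finite_set_countable/finite_set1.
  exact/countable_image/countableP.
have [x _ exp] : range e p by apply: cov; do 3!left.
have /choice[w ew] : forall i, exists x, e x = a i.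
  move=> i; have [|y _ <-] := cov (a i); last by exists y.
  by left; left; right; exists i.
pose alpha i : Fm L := Var (w i).
have ealpha : (eval e : FmAlg L -> A) \o alpha = a by exact: funext.
have step Ph : Ph `<=` FmN n ->
    D (eval e @^-1` (F `|` instance_in Ph a)) (Var x) ->
    D (eval e @^-1` F `|` instance Ph alpha) (Var x).
  move=> PhN; apply: entails_trans => t [Ft|]; first by apply: entails_refl; left.
  rewrite -ealpha -image_instance // => -[t' Pt' ett'].
  apply: (@kernel_saturated A (FmAlg L) (eval e) F
    (D (eval e @^-1` F `|` instance Ph alpha)) t') => //.
  - exact: theory_is_filter.
  - by move=> u Fu; apply: entails_refl; left.
  - by apply: entails_refl; right.
rewrite -exp; apply: (filter_eval (phi := Var x) (X := eval e @^-1` F) fF) => //.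
apply: law; apply: step => //.
- by apply: hS => // c Sc; apply: cov; left; right.
- by apply: hS' => // c Sc; apply: cov; right.
Qed.

End Transfer.

(** * Relative congruences of quotients *)

Definition pull (T U : Type) (k : U -> T) (theta : set (T * T)) : set (U * U) :=
  [set p | theta (k p.1, k p.2)].

Section Quotients.
Variables (L : language) (K : algebra L -> Prop).
Hypothesis quasiK : is_quasivariety K.
Implicit Types (A B : algebra L).

Lemma quot_class_eq A (theta : set (A * A)) a b : is_congruence theta ->
  quot_class theta a = quot_class theta b <-> theta (a, b).
Proof.
move=> cth; split=> [[ab]|ab].
  have : eqclass theta b b by exact: (cong_refl cth).
  by rewrite -ab.
apply: eq_exist; apply/seteqP; split=> c.
  exact: (cong_trans cth (cong_sym cth ab)).
exact: (cong_trans cth ab).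
Qed.

Lemma quot_class_surj A (theta : set (A * A)) (C : quotient theta) :
  exists a, quot_class theta a = C.
Proof. by exists (quot_repr C); exact: quot_reprK. Qed.

Lemma satisfies_quotient A (theta : set (A * A)) (q : quasi_equation L) :
  is_congruence theta -> satisfies (quotient theta) q <->
  forall e : variable L -> A,
    (forall E, List.In E q.1 -> theta (eval e E.1, eval e E.2)) ->
    theta (eval e q.2.1, eval e q.2.2).
Proof.
move=> cth; have hk := quot_class_hom cth; split=> sat e hyp.
  apply/(quot_class_eq _ _ cth); rewrite !(hom_eval _ _ hk); apply: sat => E /hyp.
  by move/(quot_class_eq _ _ cth); rewrite !(hom_eval _ _ hk).
have eE : e = @quot_class L A theta \o (@quot_repr L A theta \o e).
  by apply: funext => x; rewrite /= quot_reprK.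
move: hyp; rewrite /holds_eq eE -!(hom_eval _ _ hk) => hyp.
apply/(quot_class_eq _ _ cth); apply: sat => E /hyp.
by rewrite -!(hom_eval _ _ hk) => /(quot_class_eq _ _ cth).
Qed.

Section Pull.
Variables (A B : algebra L) (k : B -> A).
Hypotheses (hk : is_hom k) (ksurj : forall a, exists b, k b = a).

Lemma pull_subset th th' : pull k th `<=` pull k th' -> th `<=` th'.
Proof.
move=> sub [a b]; have [[c <-] [d <-]] := (ksurj a, ksurj b).
exact: (sub (c, d)).
Qed.

Lemma pull_inj : injective (pull k).
Proof. by move=> th th' e; apply/seteqP; split; apply: pull_subset; rewrite e. Qed.

Lemma pull_congruence theta : is_congruence (pull k theta) <-> is_congruence theta.
Proof.
split=> -[r s t i]; split.
- by move=> a; have [b <-] := ksurj a; exact: (r b).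
- by move=> a b; have [[c <-] [d <-]] := (ksurj a, ksurj b); exact: (s c d).
- move=> a b c; have [[a' <-] [b' <-]] := (ksurj a, ksurj b).
  by have [c' <-] := ksurj c; exact: (t a' b' c').
- have [r' r'K] := choice ksurj; move=> f a b ab.
  have := i f (r' \o a) (r' \o b); rewrite /pull /= !hk.
  have kE c : k \o (r' \o c) = c :> ('I_(arity f) -> A).
    by apply: funext => j; rewrite /= r'K.
  by rewrite !kE; apply=> j; rewrite !r'K.
- by move=> a; exact: r.
- by move=> a b; exact: s.
- by move=> a b c; exact: t.
- by move=> f a b ab; rewrite /pull /= !hk; exact: i.
Qed.

(** Correspondence theorem for relative congruences: [K] is defined by
quasi-equations, whose validity in a quotient is a closure property of the
congruence that can be tested along any surjective homomorphism. *)
Lemma pull_Kcongruence theta :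
  Kcongruences K B (pull k theta) <-> Kcongruences K A theta.
Proof.
have [Q KQ] := quasiK; split=> -[/pull_congruence cth /KQ sat].
  split=> //; apply/KQ => q /sat.
  have cp : is_congruence (pull k theta) by exact/pull_congruence.
  rewrite !satisfies_quotient // => {}sat e hyp.
  have [r rK] := choice ksurj.
  have eE : e = k \o (r \o e) by apply: funext => x; rewrite /= rK.
  rewrite eE -!(hom_eval _ _ hk). apply: (sat (r \o e)) => E /hyp.
  by rewrite {1 2}eE /pull /= !(hom_eval _ _ hk).
have cp : is_congruence theta by exact/pull_congruence.
split=> //; apply/KQ => q /sat.
rewrite !satisfies_quotient // => {}sat e hyp.
rewrite /pull /= !hom_eval //; apply: sat => E /hyp.
by rewrite /pull /= !hom_eval.
Qed.

Lemma congruence_is_pull eta : is_congruence eta ->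
  [set p | k p.1 = k p.2] `<=` eta -> exists theta, eta = pull k theta.
Proof.
move=> ceta ker.
exists [set p | exists b c, [/\ k b = p.1, k c = p.2 & eta (b, c)]].
apply/seteqP; split=> -[b c]; first by exists b, c.
move=> [b' [c' /= [bb' cc' e]]].
apply: (cong_trans ceta (b := b')); first by apply: ker => /=.
by apply: (cong_trans ceta e); apply: ker.
Qed.

End Pull.

Lemma Kcongruence_setT A : Kcongruences K A setT.
Proof.
have [Q KQ] := quasiK; have cT : @is_congruence L A setT by [].
by split=> //; apply/KQ => q _; apply/satisfies_quotient.
Qed.

End Quotients.

(** * Filters and relative congruences *)

Lemma has_greatest_proper_iso (T U : Type) (X : set (set T)) (Y : set (set U)) g :
  order_isomorphism X Y g -> X setT -> Y setT ->
  has_greatest_proper X <-> has_greatest_proper Y.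
Proof.
move=> [[gXY ginj gsurj] gmono] XT YT.
have gT : g setT = setT.
  have [F XF FT] := gsurj _ YT; apply/seteqP; split=> //.
  by rewrite -FT; apply/gmono.
have inj F G : X F -> X G -> g F = g G -> F = G.
  by move=> XF XG; apply: ginj; exact: mem_set.
split=> [[M [XM MT maxM]]|[M' [YM' M'T maxM']]].
  exists (g M); split=> [||_ /gsurj[F XF <-] FT]; first exact: gXY.
  - by rewrite -gT => /inj H; apply: MT; exact: H.
  - apply/gmono => //; apply: maxM => // FT'; apply: FT.
    by rewrite FT' gT.
have [M XM MM'] := gsurj _ YM'; exists M; split=> //.
  by move=> MT; apply: M'T; rewrite -MM' MT gT.
move=> F XF FT; apply/gmono => //; rewrite MM'; apply: maxM'; first exact: gXY.
by rewrite -gT => /inj H; apply: FT; exact: H.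
Qed.

Lemma completely_meet_irreducible_meet_irreducible (T : Type) (X : set (set T)) x :
  completely_meet_irreducible X x -> meet_irreducible X x.
Proof.
move=> [Xx cmi]; split=> // y z Xy Xz m.
by have [|->|->] := cmi [set y; z] _ m; [move=> _ [->|->]|left|right].
Qed.

Section Algebraized.
Variables (L : language) (D : deductive_system L) (K : algebra L -> Prop).
Hypotheses (quasiK : is_quasivariety K) (KD : algebraizes K D).
Implicit Types (A B : algebra L).

Lemma RSI_RFSI A : RSI K A -> RFSI K A /\ ~ trivial A.
Proof.
move=> [KA cmi]; split.
  by split=> //; exact: completely_meet_irreducible_meet_irreducible.
move=> [a aA]; have [Xid /(_ set0)[//|]] := cmi; split=> // z _ _ p _.
by rewrite /identity_relation /= (aA p.1) (aA p.2).
Qed.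

Lemma has_greatest_proper_filter A :
  has_greatest_proper (Kcongruences K A) <-> has_greatest_proper (filters D A).
Proof.
apply: iff_sym; apply: (has_greatest_proper_iso (KD A)).
  exact: (@setT_is_filter L D A).
exact: Kcongruence_setT.
Qed.

Lemma Omega_setT A : Omega [set: A] = setT.
Proof.
apply/seteqP; split=> // p _; exists setT => //; split=> //.
exact/compatibleP.
Qed.

Lemma Omega_inj A (F G : set A) :
  is_filter D F -> is_filter D G -> Omega F = Omega G -> F = G.
Proof.
by move=> fF fG e; apply/seteqP; split; apply/(Omega_mono KD) => //; rewrite e.
Qed.

Lemma Omega_Kcongruence A (F : set A) :
  is_filter D F -> Kcongruences K A (Omega F).
Proof. by move=> fF; have [[H _ _] _] := KD A; apply: H. Qed.

Lemma Kcongruence_Omega A (theta : set (A * A)) : Kcongruences K A theta ->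
  exists2 F, is_filter D F & Omega F = theta.
Proof. by move=> Kth; have [[_ _ /(_ _ Kth)[F fF <-]] _] := KD A; exists F. Qed.

Section QuotientByFilter.
Variables (B : algebra L) (T : set B).
Hypothesis fT : is_filter D T.
Let Q := quotient (Omega T).
Let k : B -> Q := @quot_class L B (Omega T).

Let cO : is_congruence (Omega T). Proof. by have [] := Omega_largest T. Qed.
Let hk : is_hom k. Proof. exact: quot_class_hom. Qed.
Let ksurj (C : Q) : exists b, k b = C. Proof. exact: quot_class_surj. Qed.

Lemma pull_identity : pull k (identity_relation Q) = Omega T.
Proof. by apply/seteqP; split=> -[a b] /(quot_class_eq _ _ cO). Qed.

Lemma Kcongruence_quotient z : Kcongruences K Q z ->
  exists F, [/\ is_filter D F, T `<=` F & Omega F = pull k z].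
Proof.
move=> Kz; have /Kcongruence_Omega[F fF FE] : Kcongruences K B (pull k z).
  exact/pull_Kcongruence.
exists F; split=> //; apply/(Omega_mono KD fT fF); rewrite FE -pull_identity.
move=> [a b] ab; rewrite /pull /= (ab : k a = k b).
by have [cz _] := Kz; exact: (cong_refl cz).
Qed.

Lemma filter_Kcongruence_quotient F : is_filter D F -> T `<=` F ->
  exists2 z, Kcongruences K Q z & Omega F = pull k z.
Proof.
move=> fF TF.
have [|z FE] := @congruence_is_pull _ _ B k (Omega F) (Omega_Kcongruence fF).1.
  rewrite -[X in X `<=` _]/(pull k (identity_relation Q)) pull_identity.
  exact/(Omega_mono KD).
exists z => //; apply/(pull_Kcongruence quasiK hk ksurj).
by rewrite -FE; exact: Omega_Kcongruence.
Qed.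

(** A filter that is maximal among those omitting a point is completely
meet-irreducible, since every larger filter contains the one generated by that
filter and the point. *)
Lemma maximal_omitting_RSI p : ~ T p ->
  (forall F, is_filter D F -> T `<=` F -> ~ F p -> F `<=` T) ->
  RSI K Q.
Proof.
move=> nTp maxT; split; first by have [] := Omega_Kcongruence fT.
have Kid : Kcongruences K Q (identity_relation Q).
  apply/(pull_Kcongruence quasiK hk ksurj).
  by rewrite pull_identity; exact: Omega_Kcongruence.
split=> // S SK [_ _ least]; apply: contrapT => nSid.
pose Tp := fgen D (T `|` [set p]).
have fTp : is_filter D Tp by exact: fgen_filter.
have TTp : T `<=` Tp by move=> b Tb; apply: sub_fgen; left.
have [z Kz zE] := filter_Kcongruence_quotient fTp TTp.
suff zid : z `<=` identity_relation Q.
  suff : Tp `<=` T by apply: contra_not nTp; apply; apply: sub_fgen; right.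
  apply/(Omega_mono KD fTp fT); rewrite zE -pull_identity.
  by move=> q; exact: zid.
apply: least => // y Sy; apply: (@pull_subset _ _ _ k ksurj).
have [F [fF TF FE]] := Kcongruence_quotient (SK _ Sy).
rewrite -zE -FE; apply/(Omega_mono KD fTp fF); apply: fgen_min => //.
move=> b [/TF//|->]; apply: contrapT => nFp; apply: nSid.
suff -> : identity_relation Q = y by [].
apply: (@pull_inj _ _ _ k ksurj); rewrite pull_identity -FE; congr Omega.
by apply/seteqP; split=> //; exact: maxT.
Qed.

Lemma greatest_proper_above :
  has_greatest_proper (Kcongruences K Q) ->
  exists M, [/\ is_filter D M, M <> [set: B] &
    forall F, is_filter D F -> T `<=` F -> F <> [set: B] -> F `<=` M].
Proof.
move=> [m [Km mT maxm]].
have [M [fM TM ME]] := Kcongruence_quotient Km; exists M; split=> //.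
  move=> MT; apply: mT; apply: (@pull_inj _ _ _ k ksurj).
  by rewrite -ME MT Omega_setT.
move=> F fF TF FT; have [z Kz FE] := filter_Kcongruence_quotient fF TF.
apply/(Omega_mono KD fF fM); rewrite FE ME.
suff zm : z `<=` m by move=> q; exact: zm.
apply: maxm => // zT; apply: FT; apply: Omega_inj => //.
by rewrite FE zT Omega_setT.
Qed.

End QuotientByFilter.

Lemma meet_irreducible_least_filter A :
  meet_irreducible (Kcongruences K A) (identity_relation A) ->
  exists F0, [/\ is_filter D F0, Omega F0 = identity_relation A,
    forall F, is_filter D F -> F0 `<=` F &
    forall F G, is_filter D F -> is_filter D G -> F `&` G `<=` F0 ->
      F = F0 \/ G = F0].
Proof.
move=> [Kid mi]; have [F0 f0 F0E] := Kcongruence_Omega Kid.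
have least F : is_filter D F -> F0 `<=` F.
  move=> fF; apply/(Omega_mono KD f0 fF); rewrite F0E => -[a b] ab.
  rewrite (ab : a = b).
  by have [cF _] := Omega_Kcongruence fF; exact: (cong_refl cF).
exists F0; split=> // F G fF fG FG.
have [|||E|E] := mi (Omega F) (Omega G); try exact: Omega_Kcongruence.
- split=> // [y [->|->]|z Kz zFG].
  + by rewrite -F0E; apply/(Omega_mono KD) => //; exact: least.
  + by rewrite -F0E; apply/(Omega_mono KD) => //; exact: least.
  have [H fH HE] := Kcongruence_Omega Kz.
  rewrite -HE -F0E; apply/(Omega_mono KD) => //; apply: subset_trans FG.
  by rewrite subsetI; split; apply/(Omega_mono KD) => //; rewrite HE;
    apply: zFG; [left|right].
- by left; apply: Omega_inj => //; rewrite F0E.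
- by right; apply: Omega_inj => //; rewrite F0E.
Qed.

(** Were two proper filters to have an improper join, compactness would give a
tuple [a] in one of them with [Psi n] of it in the other.  By the weak excluded
middle law the least filter is the meet of the filters generated by [Psi n] of
[a] and by [Psi m] of that.  Being meet-irreducible, it contains one of the two
sets; either way a proper filter contains a tuple together with its inconsistency
witness.  Hence a maximal proper filter contains every proper filter. *)
Lemma WEML_greatest_proper A : has_WEML D -> RFSI K A -> ~ trivial A ->
  has_greatest_proper (filters D A).
Proof.
move=> [Psi IL weml] [_ mi] ntriv.
have [F0 [f0 F0E least irr]] := meet_irreducible_least_filter mi.
have [X [finX improper]] := exists_improper_finite IL A.
have nX : ~ X `<=` F0.
  move=> /(improper _ f0) F0T; apply: ntriv; have [a] := Defs.nonempty A.
  exists a => b; have : identity_relation A (b, a) by rewrite -F0E F0T Omega_setT.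
  by [].
have [M [fM _ nXM maxM]] := maximal_filter_omitting finX f0 nX.
exists M; split=> // [MT|G fG GT]; first by apply: nXM; rewrite MT.
have Mproper : M <> setT by move=> MT; apply: nXM; rewrite MT.
pose H := fgen D (G `|` M).
have fH : is_filter D H by exact: fgen_filter.
suff nXH : ~ X `<=` H.
  apply: (@subset_trans _ H); first by move=> b Gb; apply: sub_fgen; left.
  by apply: maxM => // b Mb; apply: sub_fgen; right.
move=> /(improper _ fH) HT.
have [n [a [n0 aM PG]]] := improper_join_instance KD IL fG GT HT.
have [finPsi PsiN _] := IL n n0.
have [m [psi psiE]] := finite_enumerates finPsi.
have psiN i : FmN n (psi i).
  by apply: PsiN; rewrite -psiE.2; exists i.
have nPM : ~ instance_in (Psi n) a `<=` F0.
  move=> PF0; apply: Mproper; apply: (filter_improper IL n0 fM aM).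
  by apply: subset_trans PF0 _; exact: least.
have [m0|m_gt0] := posnP m.
  apply: nPM => b [e _ [t Pt _]]; move: Pt; rewrite -psiE.2 => -[i _ _].
  by case: i; rewrite m0.
have [_ PsimN _] := IL m m_gt0.
pose PP := instance (Psi m) psi.
have PPN : PP `<=` FmN n by exact: instance_FmN.
pose F1 := fgen D (F0 `|` instance_in (Psi n) a).
pose F2 := fgen D (F0 `|` instance_in PP a).
have [|||FE|FE] := irr F1 F2; try exact: fgen_filter.
- move=> p [p1 p2]; apply: (WEML_filter KD PsiN PPN _ f0 p1 p2).
  exact: weml psiE.
- by apply: nPM; rewrite -FE => b Pb; apply: sub_fgen; right.
have PPG : instance_in PP a `<=` G.
  apply: subset_trans (least _ fG); rewrite -FE => b Pb.
  by apply: sub_fgen; right.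
have [e [ea _]] := exists_assignment a (a (Ordinal n0)) (leqnn n).
move: PPG; rewrite (instance_in_eval PPN ea) image_instance // => PPG.
apply: GT; apply: (filter_improper IL m_gt0 fG _ PPG) => _ [i _ <-] /=.
apply: PG; rewrite (instance_in_eval PsiN ea); exists (psi i) => //.
by rewrite -psiE.2; exists i.
Qed.

(** A failure of the law extends, by Zorn's lemma, to a theory [T] maximal among
those omitting [phi], whose quotient is relatively subdirectly irreducible.  Both
[T] with [alpha] and [T] with [Psi n] of [alpha] are then consistent, so
the greatest consistent theory above [T] contains both, which is absurd. *)
Lemma greatest_proper_WEML : has_IL D ->
  (forall A, RSI K A -> has_greatest_proper (Kcongruences K A)) -> has_WEML D.
Proof.
move=> [Psi IL] gp; exists Psi => // n n0 m psi psiE Gamma alpha phi GP GPP.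
have [m0|m_gt0] := posnP m.
  apply: entails_mono GP => t [//|[u Pu _]]; move: Pu; rewrite -psiE.2 => -[i _ _].
  by case: i; rewrite m0.
have [_ PsiN ILn] := IL n n0.
have [_ PsimN ILm] := IL m m_gt0.
apply: contrapT => nG.
have [|T [fT GT nT maxT]] := @maximal_filter_omitting L D (FmAlg L) [set phi]
    (D Gamma) (finite_set1 _) (@theory_is_filter L D Gamma).
  by move/(_ phi erefl).
have nTphi : ~ T phi by move=> Tphi; apply: nT => _ ->.
have Tomit Y : D (Gamma `|` Y) phi -> ~ Y `<=` T.
  move=> GY YT; apply: nTphi; apply: filter_is_theory fT _ GY => t [Gt|/YT//].
  by apply: GT; exact: entails_refl.
have [|M [fM Mproper maxM]] := greatest_proper_above fT (gp _ _).
  apply: (maximal_omitting_RSI fT nTphi) => F fF TF nFphi.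
  by apply: maxT => // /(_ phi erefl).
have above Y : ~ inconsistent D (T `|` Y) -> Y `<=` M.
  move=> con t Yt; apply: (maxM (D (T `|` Y))).
  - exact: theory_is_filter.
  - by move=> u Tu; apply: entails_refl; left.
  - by move=> E; apply: con => u; rewrite E.
  - by apply: entails_refl; right.
have TY Y : entails_set D T Y -> Y `<=` T.
  by move=> TY t /TY; exact: filter_is_theory.
apply: Mproper; apply: (@filter_improper _ _ _ IL (FmAlg L) n alpha M n0 fM).
  by apply: above => /ILn/TY; exact: Tomit.
rewrite -(@instanceE L) //; apply: above.
have -> : instance (Psi n) alpha = range (@eval L (FmAlg L) (assign alpha) \o psi).
  by rewrite /instance -psiE.2 image_comp.
by move=> /ILm; rewrite -instance_instance // => /TY; exact: Tomit.
Qed.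

End Algebraized.

(** * The equivalence *)

Theorem theorem8p5 (L : language) (D : deductive_system L)
    (K : algebra L -> Prop) :
  has_IL D -> is_quasivariety K -> algebraizes K D ->
  let cond_i := has_WEML D in
  let cond_ii := forall A : algebra L, RFSI K A -> ~ trivial A ->
    has_greatest_proper (Kcongruences K A) in
  let cond_iii := forall A : algebra L, RSI K A ->
    has_greatest_proper (Kcongruences K A) in
  (cond_i <-> cond_ii) /\ (cond_ii <-> cond_iii) /\
  (forall A : algebra L, RFSI K A -> ~ trivial A ->
    (has_greatest_proper (Kcongruences K A) <->
     has_greatest_proper (filters D A))).
Proof.
move=> IL quasiK KD cond_i cond_ii cond_iii.
have i_ii : cond_i -> cond_ii.
  move=> weml A rfsi ntriv; apply/(has_greatest_proper_filter quasiK KD).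
  exact: WEML_greatest_proper.
have ii_iii : cond_ii -> cond_iii by move=> ii A /RSI_RFSI[]; exact: ii.
have iii_i : cond_iii -> cond_i by exact: greatest_proper_WEML.
split; first by split=> // /ii_iii.
split; first by split=> // /iii_i.
by move=> A _ _; exact: has_greatest_proper_filter.
Qed.
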